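(* For all formulas $\alpha,\beta$: (1) $\sqrt{id}\sqrt{id}\,\alpha\equiv\alpha$; (2) $\sqrt{id}\,\mathbf f\equiv\sqrt{id}\,\mathbf t$; (3) $\lnot\sqrt{id}\,\mathbf f\equiv\sqrt{id}\,\mathbf f$ and $\lnot\sqrt{id}\,\mathbf t\equiv\sqrt{id}\,\mathbf t$; (4) $\sqrt{id}(\alpha\land\beta)\equiv\sqrt{id}\,\mathbf f$; (5) $\sqrt\lnot\sqrt\lnot\,\alpha\equiv\lnot\alpha$; (6) $\sqrt\lnot\,\mathbf f\equiv\sqrt\lnot\,\mathbf t$; (7) $\lnot\sqrt\lnot\,\mathbf f\equiv\sqrt\lnot\,\mathbf f$ and $\lnot\sqrt\lnot\,\mathbf t\equiv\sqrt\lnot\,\mathbf t$; (8) $\lnot\sqrt\lnot\,\alpha\equiv\sqrt\lnot\lnot\alpha$; (9) $\sqrt\lnot(\alpha\land\beta)\equiv\sqrt\lnot\,\mathbf f$; (10) $\sqrt{id}\sqrt\lnot\,\alpha\equiv\sqrt{id}\,\alpha$; (11) $\sqrt\lnot\sqrt{id}\,\alpha\equiv\lnot\sqrt\lnot\,\alpha$; (12) $\sqrt{id}\sqrt\lnot(\alpha\land\beta)\equiv\sqrt\lnot\,\mathbf f$; (13) $\sqrt\lnot\sqrt{id}(\alpha\land\beta)\equiv\sqrt\lnot\,\mathbf f$.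
   Context: Hilbert spaces and states: for $n\ge1$, $\mathcal H^{(n)}=(\mathbb C^2)^{\otimes n}$ with canonical basis $|x_1,\dots,x_n\rangle$ ($x_i\in\{0,1\}$, $|0\rangle=(1,0)$, $|1\rangle=(0,1)$); $\mathfrak D(\mathcal H^{(n)})$ is the set of density operators (qumixes). A truth-perspective is a unitary $\mathfrak T$ on $\mathbb C^2$, $\mathfrak T^{(n)}=\mathfrak T^{\otimes n}$. $^{\mathfrak T}P_1^{(n)}$ (resp. $^{\mathfrak T}P_0^{(n)}$) is the projection onto the span of the $\mathfrak T^{(n)}|x_1,\dots,x_n\rangle$ with $x_n=1$ (resp. $0$). $\mathtt p_{\mathfrak T}(\rho)=\mathrm{tr}(^{\mathfrak T}P_1^{(n)}\rho)$, and $\rho\preceq_{\mathfrak T}\sigma$ iff $\mathtt p_{\mathfrak T}(\rho)\le\mathtt p_{\mathfrak T}(\sigma)$. $Red^{(j_1,\dots,j_s)}_{[n_1,\dots,n_t]}(\rho)$ is the reduced state of $\rho$ on factors $j_1,\dots,j_s$ of $\mathcal H^{(n_1)}\otimes\cdots\otimes\mathcal H^{(n_t)}$. Gates (canonical basis, extended linearly): $\mathtt{NOT}^{(n)}|x_1..x_n\rangle=|x_1..x_{n-1}\rangle\otimes|1-x_n\rangle$; $\sqrt{\mathtt I}^{(n)}|x_1..x_n\rangle=|x_1..x_{n-1}\rangle\otimes\frac1{\sqrt2}((-1)^{x_n}|x_n\rangle+|1-x_n\rangle)$; $\sqrt{\mathtt{NOT}}^{(n)}|x_1..x_n\rangle=|x_1..x_{n-1}\rangle\otimes(\frac{1-i}2|x_n\rangle+\frac{1+i}2|1-x_n\rangle)$;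 $\mathtt{XOR}^{(m,n)}|x_1..x_m,y_1..y_n\rangle=|x_1..x_m,y_1..y_{n-1}\rangle\otimes|x_m\oplus y_n\rangle$; $\mathtt T^{(m,n,p)}|x_1..x_m,y_1..y_n,z_1..z_p\rangle=|x_1..x_m,y_1..y_n,z_1..z_{p-1}\rangle\otimes|x_my_n\oplus z_p\rangle$ ($\oplus$ addition mod 2). For a gate $G$ on $\mathcal H^{(n)}$: $G_{\mathfrak T}=\mathfrak T^{(n)}G\mathfrak T^{(n)\dagger}$, $^{\mathfrak D}G_{\mathfrak T}(\rho)=G_{\mathfrak T}\rho G_{\mathfrak T}^\dagger$. Language: formulas built from atomic formulas (including distinguished atoms $\mathbf t,\mathbf f$) with unary $\lnot,\sqrt{id},\sqrt\lnot$, binary $\uplus$, ternary $\intercal$; $\alpha\land\beta:=\intercal(\alpha,\beta,\mathbf f)$. $At(\alpha)$ = number of occurrences of atomic formulas in $\alpha$. Syntactical tree: $Level_1^\alpha=(\alpha)$; $Level_{i+1}^\alpha$ is obtained from $Level_i^\alpha=(\beta_1,\dots,\beta_r)$ by replacing each non-atomic $\beta_j$ by its immediate subformulas (arguments, in order) and keeping atomic $\beta_j$; the last level $Level_h^\alpha$ lists all atomic occurrences. $\mathcal H^{(At\alpha)}=\bigotimes_j\mathcal H^{(At\beta_j)}$. The $\mathfrak T$-gate $G^\alpha_{\mathfrak T(i)}$ ($1\le i<h$) is the tensor product over $j$ of: identity of $\mathbb C^2$ if $\beta_j$ atomic; $\mathtt{NOT}_{\mathfrak T}^{(At\beta)}$,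 $\sqrt{\mathtt I}_{\mathfrak T}^{(At\beta)}$, $\sqrt{\mathtt{NOT}}_{\mathfrak T}^{(At\beta)}$ for $\lnot\beta,\sqrt{id}\beta,\sqrt\lnot\beta$; $\mathtt{XOR}_{\mathfrak T}^{(At\beta',At\beta'')}$ for $\beta'\uplus\beta''$; $\mathtt T_{\mathfrak T}^{(At\beta',At\beta'',At\beta''')}$ for $\intercal(\beta',\beta'',\beta''')$. Holistic model: a map $\mathtt{Hol}_{\mathfrak T}$ assigning to each level $Level_i^\alpha$ of each formula $\alpha$ a qumix in $\mathfrak D(\mathcal H^{(At\alpha)})$ such that (a) $\mathtt{Hol}_{\mathfrak T}(Level_i^\alpha)={}^{\mathfrak D}G^\alpha_{\mathfrak T(i)}(\mathtt{Hol}_{\mathfrak T}(Level_{i+1}^\alpha))$ for $1\le i<h$; (b) (normality) for each $\gamma$, with the contextual meaning of the occurrence $\beta_j$ in $Level_i^\gamma=(\beta_1,\dots,\beta_r)$ defined as $Red^{(j)}_{[At\beta_1,\dots,At\beta_r]}(\mathtt{Hol}_{\mathfrak T}(Level_i^\gamma))$, all occurrences of the same subformula $\beta$ in the tree of $\gamma$ have the same contextual meaning, denoted $\mathtt{Hol}^\gamma_{\mathfrak T}(\beta)$; (c) every occurrence of $\mathbf f$ (resp. $\mathbf t$) has contextual meaning $^{\mathfrak T}P_0^{(1)}$ (resp. $^{\mathfrak T}P_1^{(1)}$). Logical consequence: $\alpha\vDash\beta$ iff for every truth-perspective $\mathfrak T$, every formula $\gamma$ having both $\alpha$ and $\beta$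 as subformulas (a formula counts as a subformula of itself), and every holistic model $\mathtt{Hol}_{\mathfrak T}$, $\mathtt{Hol}^\gamma_{\mathfrak T}(\alpha)\preceq_{\mathfrak T}\mathtt{Hol}^\gamma_{\mathfrak T}(\beta)$. $\alpha\equiv\beta$ means $\alpha\vDash\beta$ and $\beta\vDash\alpha$. *)

(* Defs.v *)
(* Quantum computational logic with holistic semantics.
   Complex numbers: an arbitrary numeric closed field C (e.g. R[i], algC). *)
From HB Require Import structures.
From mathcomp Require Import all_boot all_order all_algebra.
Set Implicit Arguments. Unset Strict Implicit. Unset Printing Implicit Defensive.
Import Order.TTheory GRing.Theory Num.Theory.
Local Open Scope ring_scope.

Inductive qform :=
  | Atom of nat
  | Tt
  | Ff
  | Neg of qform
  | Sqid of qform
  | Sqneg of qform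
  | Xor of qform & qform
  | Toff of qform & qform & qform.

Definition conjf (a b : qform) : qform := Toff a b Ff.

Definition is_atomic (a : qform) : bool :=
  match a with Atom _ | Tt | Ff => true | _ => false end.

Fixpoint At (a : qform) : nat :=
  match a with
  | Atom _ | Tt | Ff => 1%N
  | Neg b | Sqid b | Sqneg b => At b
  | Xor b c => (At b + At c)%N
  | Toff b c d => (At b + At c + At d)%N
  end.

Fixpoint subf (a g : qform) : Prop :=
  a = g \/
  match g with
  | Atom _ | Tt | Ff => False
  | Neg b | Sqid b | Sqneg b => subf a b
  | Xor b c => subf a b \/ subf a c
  | Toff b c d => subf a b \/ subf a c \/ subf a d
  end.

Definition expand (a : qform) : seq qform :=
  match a with
  | Atom _ | Tt | Ff => [:: a]
  | Neg b | Sqid b | Sqneg b => [:: b]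
  | Xor b c => [:: b; c]
  | Toff b c d => [:: b; c; d]
  end.

Definition step (l : seq qform) : seq qform := flatten (map expand l).

(* Level_i^a, for i >= 1 (1-based as in the paper) *)
Definition level (a : qform) (i : nat) : seq qform := iter i.-1 step [:: a].

Fixpoint depth (a : qform) : nat :=
  match a with
  | Atom _ | Tt | Ff => 0%N
  | Neg b | Sqid b | Sqneg b => (depth b).+1
  | Xor b c => (maxn (depth b) (depth c)).+1
  | Toff b c d => (maxn (depth b) (maxn (depth c) (depth d))).+1
  end.

(* h : index of the last level (the one listing all atomic occurrences) *)
Definition height (a : qform) : nat := (depth a).+1.

(* Basis vectors |x_1,...,x_n> are labelled by bit sequences; a "kernel" gives
   the matrix entries <x|A|y> in the canonical basis. *)
Definition kern (C : Type) := seq bool -> seq bool -> C.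
(* an operator on H^(n) : matrix indexed by the basis labels of length n *)
Definition op (C : Type) (n : nat) := n.-tuple bool -> n.-tuple bool -> C.

Definition init (s : seq bool) : seq bool := take (size s).-1 s.
Definition lastb (s : seq bool) : bool := last false s.

(* splitting a label of H^(n_1) (x) ... (x) H^(n_r) into its r blocks *)
Fixpoint chunks (ns : seq nat) (s : seq bool) : seq (seq bool) :=
  match ns with
  | [::] => [::]
  | k :: ns' => take k s :: chunks ns' (drop k s)
  end.


(* truth perspective: unitary 2x2 matrix, entries T i j = <i|T|j> *)
Definition unitary2 (C : numClosedFieldType) (T : bool -> bool -> C) : Prop :=
  (forall i j : bool, \sum_(k : bool) (T k i)^* * T k j = (i == j)%:R) /\
  (forall i j : bool, \sum_(k : bool) T i k * (T j k)^* = (i == j)%:R).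

Definition tensT (C : numClosedFieldType) (T : bool -> bool -> C) : kern C :=
  fun x u => \prod_(k < size x) T (nth false x k) (nth false u k).

Definition gateT (C : numClosedFieldType) (T : bool -> bool -> C) (n : nat)
  (g : kern C) : kern C :=
  fun x y => \sum_(u : n.-tuple bool) \sum_(v : n.-tuple bool)
               tensT T x u * g u v * (tensT T y v)^*.

Definition permK (C : numClosedFieldType) (f : seq bool -> seq bool) : kern C :=
  fun x y => (x == f y)%:R.

Definition notK (C : numClosedFieldType) : kern C :=
  permK C (fun s => rcons (init s) (~~ lastb s)).

Definition xorK (C : numClosedFieldType) (m : nat) : kern C :=
  permK C (fun s => rcons (init s) (addb (nth false s m.-1) (lastb s))).

(* T^(m,n,p) : last bit becomes x_m y_n (+) z_p ; mn = m + n *)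
Definition toffK (C : numClosedFieldType) (m mn : nat) : kern C :=
  permK C (fun s => rcons (init s)
     (addb (nth false s m.-1 && nth false s mn.-1) (lastb s))).

(* sqrt I : |x'..,x_n> |-> |x'> (x) 1/sqrt2 ((-1)^{x_n}|x_n> + |1-x_n>) *)
Definition sqidK (C : numClosedFieldType) : kern C :=
  fun x y => (init x == init y)%:R *
    (if lastb x == lastb y then (if lastb y then -1 else 1) / sqrtC 2
     else 1 / sqrtC 2).

(* sqrt NOT : |x'..,x_n> |-> |x'> (x) ((1-i)/2 |x_n> + (1+i)/2 |1-x_n>) *)
Definition sqnotK (C : numClosedFieldType) : kern C :=
  fun x y => (init x == init y)%:R *
    (if lastb x == lastb y then (1 - 'i) / 2 else (1 + 'i) / 2).

Definition compK (C : numClosedFieldType) (T : bool -> bool -> C) (b : qform)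
  : kern C :=
  match b with
  | Atom _ | Tt | Ff => fun x y => (x == y)%:R
  | Neg c => gateT T (At c) (notK C)
  | Sqid c => gateT T (At c) (sqidK C)
  | Sqneg c => gateT T (At c) (sqnotK C)
  | Xor c d => gateT T (At c + At d) (xorK C (At c))
  | Toff c d e => gateT T (At c + At d + At e) (toffK C (At c) (At c + At d))
  end.

(* G^a_{T(i)} : tensor product over the entries of Level_i *)
Definition levelK (C : numClosedFieldType) (T : bool -> bool -> C)
  (lvl : seq qform) : kern C :=
  fun x y => \prod_(j < size lvl)
     compK T (nth Ff lvl j) (nth [::] (chunks (map At lvl) x) j)
                            (nth [::] (chunks (map At lvl) y) j).

Definition applyK (C : numClosedFieldType) (n : nat) (G : kern C) (rho : op C n)
  : op C n :=
  fun x y => \sum_(u : n.-tuple bool) \sum_(v : n.-tuple bool)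
               G x u * rho u v * (G y v)^*.

Definition density (C : numClosedFieldType) (n : nat) (rho : op C n) : Prop :=
  (forall v : n.-tuple bool -> C,
     0 <= \sum_(x : n.-tuple bool) \sum_(y : n.-tuple bool) (v x)^* * rho x y * v y)
  /\ \sum_(x : n.-tuple bool) rho x x = 1.

Definition P1 (C : numClosedFieldType) (T : bool -> bool -> C) (n : nat) : kern C :=
  fun x y => \sum_(u : n.-tuple bool | lastb u) tensT T x u * (tensT T y u)^*.
Definition P0 (C : numClosedFieldType) (T : bool -> bool -> C) (n : nat) : kern C :=
  fun x y => \sum_(u : n.-tuple bool | ~~ lastb u) tensT T x u * (tensT T y u)^*.

Definition pT (C : numClosedFieldType) (T : bool -> bool -> C) (n : nat)
  (rho : kern C) : C :=
  \sum_(x : n.-tuple bool) \sum_(y : n.-tuple bool) P1 T n x y * rho y x.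

(* Red^{(j)}_{[ns]}(rho) : partial trace over all blocks but the j-th (0-based) *)
Definition red (C : numClosedFieldType) (N : nat) (ns : seq nat) (j : nat)
  (rho : op C N) : kern C :=
  fun a b => \sum_(x : N.-tuple bool) \sum_(y : N.-tuple bool)
    ((nth [::] (chunks ns x) j == a) && (nth [::] (chunks ns y) j == b) &&
     [forall k : 'I_(size ns), (k != j :> nat) ==>
        (nth [::] (chunks ns x) k == nth [::] (chunks ns y) k)])%:R * rho x y.

Definition hol_map (C : numClosedFieldType) := forall a : qform, nat -> op C (At a).

(* contextual meaning of the j-th (0-based) entry of Level_i^g *)
Definition cmean (C : numClosedFieldType) (Hol : hol_map C) (g : qform)
  (i j : nat) : kern C :=
  red (map At (level g i)) j (Hol g i).

Definition occ (g b : qform) (i j : nat) : Prop :=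
  (1 <= i <= height g)%N /\ (j < size (level g i))%N /\ nth Ff (level g i) j = b.

Definition holistic (C : numClosedFieldType) (T : bool -> bool -> C)
  (Hol : hol_map C) : Prop :=
  (forall a i, (1 <= i <= height a)%N -> density (Hol a i)) /\
  (forall a i, (1 <= i < height a)%N ->
     Hol a i = applyK (levelK T (level a i)) (Hol a i.+1)) /\
  (forall g b i j i' j', occ g b i j -> occ g b i' j' ->
     forall x y : (At b).-tuple bool, cmean Hol g i j x y = cmean Hol g i' j' x y) /\
  (forall g i j, occ g Ff i j ->
     forall x y : 1.-tuple bool, cmean Hol g i j x y = P0 T 1 x y) /\
  (forall g i j, occ g Tt i j ->
     forall x y : 1.-tuple bool, cmean Hol g i j x y = P1 T 1 x y).

(* logical consequence a |= b  (Hol^g_T(a) is the contextual meaning of any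
   occurrence of a in g; by normality they all coincide) *)
Definition lconseq (C : numClosedFieldType) (a b : qform) : Prop :=
  forall T : bool -> bool -> C, unitary2 T ->
  forall g : qform, subf a g -> subf b g ->
  forall Hol : hol_map C, holistic T Hol ->
  forall i j i' j', occ g a i j -> occ g b i' j' ->
    pT T (At a) (cmean Hol g i j) <= pT T (At b) (cmean Hol g i' j').

Definition lequiv (C : numClosedFieldType) (a b : qform) : Prop :=
  lconseq C a b /\ lconseq C b a.

(* Main.v *)
(* Conjugating by T turns every gate into its canonical form, and tracing out the
   other factors of a level commutes with the level gate because the gates on those
   factors are isometries.  Hence the probability of a formula is the (1,1) entry of
   the 2x2 reduced state q of its last qubit, expressed in the basis T|0>, T|1>.  A
   unary connective conjugates q by a fixed 2x2 matrix; q is diag(1,0) for f and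
   diag(0,1) for t.  For a conjunction the target qubit of the Toffoli gate is in the
   pure state f, so by positivity the off-diagonal entries of q vanish.  Normality
   identifies the states of the repeated subformulas, and every item becomes an
   identity between entries of 2x2 matrices. *)
Require Import Defs.
From mathcomp Require Import all_boot all_order all_algebra.
From mathcomp Require Import ring zify.
Set Implicit Arguments. Unset Strict Implicit. Unset Printing Implicit Defensive.
Import Order.TTheory GRing.Theory Num.Theory.
Local Open Scope ring_scope.

Section Kernels.
Variable C : numClosedFieldType.
Implicit Types (F : seq bool -> C) (A B G K R : kern C) (n m : nat).
Implicit Types (x y u v w : seq bool).

(** * Sums over bit strings of a fixed length *)

Lemma sum_tuple0 F : \sum_(x : 0.-tuple bool) F x = F [::].
Proof. by rewrite (big_pred1 [tuple]) // => x; rewrite [x]tuple0 /= eqxx. Qed.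

Lemma sum_tuple_cons n F :
  \sum_(x : n.+1.-tuple bool) F x =
  \sum_(b : bool) \sum_(x : n.-tuple bool) F (b :: x).
Proof.
rewrite pair_big /=.
rewrite (reindex (fun p : bool * n.-tuple bool => [tuple of p.1 :: p.2])) //=.
exists (fun t => (thead t, [tuple of behead t])) => [[b x] _ | t _] /=.
  by rewrite theadE; congr pair; apply: val_inj.
by rewrite [RHS]tuple_eta; apply: val_inj.
Qed.

Lemma sum_tuple_cat m n F :
  \sum_(x : (m + n).-tuple bool) F x =
  \sum_(x : m.-tuple bool) \sum_(y : n.-tuple bool) F (x ++ y).
Proof.
elim: m F => [|m IH] F.
  by rewrite (sum_tuple0 (fun x => \sum_(y : n.-tuple bool) F (x ++ y))).
rewrite (sum_tuple_cons _ (fun x => \sum_(y : n.-tuple bool) F (x ++ y))).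
rewrite addSn sum_tuple_cons; apply: eq_bigr => b _.
exact: (IH (fun x => F (b :: x))).
Qed.

Lemma sum_tuple1 F : \sum_(x : 1.-tuple bool) F x = \sum_(b : bool) F [:: b].
Proof.
by rewrite sum_tuple_cons; apply: eq_bigr => b _; rewrite (sum_tuple0 (fun x => F (b :: x))).
Qed.

Lemma sum_tuple_rcons n F :
  \sum_(x : n.+1.-tuple bool) F x =
  \sum_(x : n.-tuple bool) \sum_(b : bool) F (rcons x b).
Proof.
rewrite -addn1 sum_tuple_cat; apply: eq_bigr => x _.
by rewrite (sum_tuple1 (fun y => F (x ++ y))); apply: eq_bigr => b _; rewrite cats1.
Qed.

(** Mostly used from right to left: a single value is spread into a sum against a delta, so that two
    expressions can be compared term by term. *)
Lemma sum_tuple_delta n F u :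
  size u = n -> \sum_(x : n.-tuple bool) (tval x == u)%:R * F x = F u.
Proof.
move=> <-; rewrite (bigD1 (in_tuple u)) //= eqxx mul1r big1 ?addr0 // => x.
by rewrite -val_eqE /= => /negPf ->; rewrite mul0r.
Qed.

(** * Operators as kernels: conjugation, isometries, tensor products *)

(** [R] multiplied by [G] on the left and by its adjoint on the right. Untyped bit sequences let
    labels be split and concatenated without casts between tuple lengths. *)
Definition conjK n G R : kern C := fun x y =>
  \sum_(u : n.-tuple bool) \sum_(v : n.-tuple bool) G x u * R u v * (G y v)^*.

Definition mulK n A B : kern C := fun x y =>
  \sum_(u : n.-tuple bool) A x u * B u y.

Definition eqK n A B := forall x y : seq bool, size x = n -> size y = n -> A x y = B x y.

Definition isomK n K := forall u v : seq bool, size u = n -> size v = n ->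
  \sum_(x : n.-tuple bool) (K x u)^* * K x v = (u == v)%:R.

(** [B] may be rectangular, from length [m] to length [n]; this covers restrictions of [R] to
    shorter labels. *)
Lemma conjK_mul m n A B R x y :
  conjK n A (conjK m B R) x y = conjK m (mulK n A B) R x y.
Proof.
rewrite /conjK /mulK.
transitivity (\sum_(u : n.-tuple bool) \sum_(v : n.-tuple bool)
   \sum_(s : m.-tuple bool) \sum_(t : m.-tuple bool)
    A x u * B u s * R s t * ((A y v)^* * (B v t)^*)).
  apply: eq_bigr => u _; apply: eq_bigr => v _.
  rewrite mulr_sumr mulr_suml; apply: eq_bigr => s _.
  rewrite mulr_sumr mulr_suml; apply: eq_bigr => t _; ring.
under eq_bigr do rewrite exchange_big /=.
rewrite exchange_big; apply: eq_bigr => s _ /=.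
under eq_bigr do rewrite exchange_big /=.
rewrite exchange_big; apply: eq_bigr => t _ /=.
rewrite mulr_suml mulr_suml; apply: eq_bigr => u _.
rewrite rmorph_sum mulr_sumr; apply: eq_bigr => v _ /=.
by rewrite rmorphM.
Qed.

Lemma conjK_ext n A A' R R' :
  eqK n A A' -> eqK n R R' -> eqK n (conjK n A R) (conjK n A' R').
Proof.
move=> eA eR x y sx sy; apply: eq_bigr => u _; apply: eq_bigr => v _.
by rewrite eA ?eR ?eA ?size_tuple.
Qed.

Lemma isomK_ext n A A' : eqK n A A' -> isomK n A -> isomK n A'.
Proof.
move=> eA iA u v su sv; rewrite -iA //; apply: eq_bigr => x _.
by rewrite !eA ?size_tuple.
Qed.

Lemma isomK_mul n A B : isomK n A -> isomK n B -> isomK n (mulK n A B).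
Proof.
move=> iA iB u v su sv; rewrite -iB //.
transitivity (\sum_(s : n.-tuple bool) \sum_(t : n.-tuple bool)
   (B s u)^* * B t v * (\sum_(x : n.-tuple bool) (A x s)^* * A x t)).
  rewrite /mulK; under eq_bigr => x _.
    rewrite rmorph_sum big_distrlr /=.
    under eq_bigr do under eq_bigr do rewrite rmorphM.
    over.
  rewrite exchange_big /=; apply: eq_bigr => s _.
  rewrite exchange_big /=; apply: eq_bigr => t _.
  rewrite mulr_sumr; apply: eq_bigr => x _; ring.
apply: eq_bigr => s _.
rewrite -(sum_tuple_delta (fun t => (B s u)^* * B t v) (size_tuple s)).
apply: eq_bigr => t _; rewrite iA ?size_tuple // mulrC.
by rewrite eq_sym.
Qed.

Lemma eqseq_split n u v : size u = size v ->
  (u == v) = (take n u == take n v) && (drop n u == drop n v).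
Proof.
move=> suv; rewrite -{1}(cat_take_drop n u) -{1}(cat_take_drop n v) eqseq_cat //.
by rewrite !size_take suv.
Qed.

(** A relation and not a construction: level gates are defined on whole labels, and it records how
    they factor on concatenated ones. *)
Definition tensorK m n K K1 K2 := forall s t x y : seq bool,
  size s = m -> size t = m -> size x = n -> size y = n ->
  K (s ++ x) (t ++ y) = K1 s t * K2 x y.

Lemma isomK_tensor m n K K1 K2 : tensorK m n K K1 K2 ->
  isomK m K1 -> isomK n K2 -> isomK (m + n) K.
Proof.
move=> eK i1 i2 u v su sv; rewrite (@eqseq_split m) ?sv // -mulnb natrM.
have st w : size w = (m + n)%N -> size (take m w) = m by move=> sw; rewrite size_takel ?sw; lia.
have sd w : size w = (m + n)%N -> size (drop m w) = n by move=> sw; rewrite size_drop sw; lia.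
rewrite -i1 ?st // -i2 ?sd // big_distrlr (sum_tuple_cat _ _ (fun x => (K x u)^* * K x v)) /=.
apply: eq_bigr => s _; apply: eq_bigr => x _.
rewrite -{1}(cat_take_drop m u) -{1}(cat_take_drop m v).
rewrite !eK ?size_tuple ?st ?sd // rmorphM; ring.
Qed.

(** * Partial traces over leading or trailing bits *)

Definition margl m R : kern C := fun x y =>
  \sum_(s : m.-tuple bool) R (s ++ x) (s ++ y).
Definition margr m R : kern C := fun x y =>
  \sum_(s : m.-tuple bool) R (x ++ s) (y ++ s).

(** Inside the trace [K1] meets its adjoint, and [isomK] turns that product into a delta: a gate on
    the traced-out bits leaves no trace on the others. *)
Lemma margl_conj m n K K1 K2 R : tensorK m n K K1 K2 -> isomK m K1 ->
  eqK n (margl m (conjK (m + n) K R)) (conjK n K2 (margl m R)).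
Proof.
move=> eK i1 x y sx sy; rewrite /margl /conjK.
transitivity (\sum_(u : n.-tuple bool) \sum_(v : n.-tuple bool)
  \sum_(u1 : m.-tuple bool) \sum_(v1 : m.-tuple bool)
   K2 x u * R (u1 ++ u) (v1 ++ v) * (K2 y v)^* *
   \sum_(s : m.-tuple bool) (K1 s v1)^* * K1 s u1).
  transitivity (\sum_(s : m.-tuple bool) \sum_(u : n.-tuple bool) \sum_(v : n.-tuple bool)
   \sum_(u1 : m.-tuple bool) \sum_(v1 : m.-tuple bool)
     K2 x u * R (u1 ++ u) (v1 ++ v) * (K2 y v)^* * ((K1 s v1)^* * K1 s u1)).
    apply: eq_bigr => s _.
    rewrite (sum_tuple_cat _ _ (fun u => \sum_(v : (m + n).-tuple bool)
       K (s ++ x) u * R u v * (K (s ++ y) v)^*)).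
    rewrite exchange_big; apply: eq_bigr => u _ /=.
    rewrite [RHS]exchange_big; apply: eq_bigr => u1 _ /=.
    rewrite (sum_tuple_cat _ _ (fun v => K (s ++ x) (u1 ++ u) * R (u1 ++ u) v * (K (s ++ y) v)^*)).
    rewrite exchange_big; apply: eq_bigr => v _; apply: eq_bigr => v1 _ /=.
    rewrite !eK ?size_tuple // rmorphM; ring.
  rewrite exchange_big; apply: eq_bigr => u _ /=.
  rewrite exchange_big; apply: eq_bigr => v _ /=.
  rewrite exchange_big; apply: eq_bigr => u1 _ /=.
  rewrite exchange_big; apply: eq_bigr => v1 _ /=.
  by rewrite mulr_sumr.
apply: eq_bigr => u _; apply: eq_bigr => v _.
rewrite mulr_sumr mulr_suml; apply: eq_bigr => u1 _.
rewrite -(sum_tuple_delta (fun v1 => K2 x u * R (u1 ++ u) (v1 ++ v) * (K2 y v)^*) (size_tuple u1)).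
by apply: eq_bigr => v1 _; rewrite i1 ?size_tuple // mulrC.
Qed.

Lemma margr_conj m n K K1 K2 R : tensorK n m K K2 K1 -> isomK m K1 ->
  eqK n (margr m (conjK (n + m) K R)) (conjK n K2 (margr m R)).
Proof.
move=> eK i1 x y sx sy; rewrite /margr /conjK.
transitivity (\sum_(u : n.-tuple bool) \sum_(v : n.-tuple bool)
  \sum_(u1 : m.-tuple bool) \sum_(v1 : m.-tuple bool)
   K2 x u * R (u ++ u1) (v ++ v1) * (K2 y v)^* *
   \sum_(s : m.-tuple bool) (K1 s v1)^* * K1 s u1).
  transitivity (\sum_(s : m.-tuple bool) \sum_(u : n.-tuple bool) \sum_(v : n.-tuple bool)
   \sum_(u1 : m.-tuple bool) \sum_(v1 : m.-tuple bool)
     K2 x u * R (u ++ u1) (v ++ v1) * (K2 y v)^* * ((K1 s v1)^* * K1 s u1)).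
    apply: eq_bigr => s _.
    rewrite (sum_tuple_cat _ _ (fun u => \sum_(v : (n + m).-tuple bool)
       K (x ++ s) u * R u v * (K (y ++ s) v)^*)).
    apply: eq_bigr => u _ /=.
    rewrite [RHS]exchange_big; apply: eq_bigr => u1 _ /=.
    rewrite (sum_tuple_cat _ _ (fun v => K (x ++ s) (u ++ u1) * R (u ++ u1) v * (K (y ++ s) v)^*)).
    apply: eq_bigr => v _; apply: eq_bigr => v1 _ /=.
    rewrite !eK ?size_tuple // rmorphM; ring.
  rewrite exchange_big; apply: eq_bigr => u _ /=.
  rewrite exchange_big; apply: eq_bigr => v _ /=.
  rewrite exchange_big; apply: eq_bigr => u1 _ /=.
  rewrite exchange_big; apply: eq_bigr => v1 _ /=.
  by rewrite mulr_sumr.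
apply: eq_bigr => u _; apply: eq_bigr => v _.
rewrite mulr_sumr mulr_suml; apply: eq_bigr => u1 _.
rewrite -(sum_tuple_delta (fun v1 => K2 x u * R (u ++ u1) (v ++ v1) * (K2 y v)^*) (size_tuple u1)).
by apply: eq_bigr => v1 _; rewrite i1 ?size_tuple // mulrC.
Qed.

Lemma margl_ext m n R R' : eqK (m + n) R R' -> eqK n (margl m R) (margl m R').
Proof.
by move=> eR x y sx sy; apply: eq_bigr => s _; rewrite eR // size_cat size_tuple ?sx ?sy.
Qed.

Lemma margr_ext m n R R' : eqK (n + m) R R' -> eqK n (margr m R) (margr m R').
Proof.
by move=> eR x y sx sy; apply: eq_bigr => s _; rewrite eR // size_cat size_tuple ?sx ?sy.
Qed.

Lemma margl_add m n R x y : margl (m + n) R x y = margl n (margl m R) x y.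
Proof.
rewrite /margl (sum_tuple_cat _ _ (fun s => R (s ++ x) (s ++ y))) exchange_big /=.
by apply: eq_bigr => s _; apply: eq_bigr => t _; rewrite !catA.
Qed.

Lemma margl_margr m n R x y : margl m (margr n R) x y = margr n (margl m R) x y.
Proof.
rewrite /margl /margr exchange_big /=.
by apply: eq_bigr => s _; apply: eq_bigr => t _; rewrite !catA.
Qed.

(** * Positive kernels *)

(** The conjugated row of [G] at [x] is the usual test vector; quantifying over whole kernels makes
    stability under conjugation immediate. *)
Definition posK n R := forall G x, 0 <= conjK n G R x x.

Lemma posK_conj n G R : posK n R -> posK n (conjK n G R).
Proof. by move=> pR A x; rewrite conjK_mul. Qed.

(** Reading [R] through a map of labels is conjugation by a 0/1 kernel, hence keeps positivity;
    partial traces are sums of such readings. *)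
Lemma conjK_pull m (f : seq bool -> seq bool) R x y :
  size (f x) = m -> size (f y) = m ->
  conjK m (fun x u => (u == f x)%:R) R x y = R (f x) (f y).
Proof.
move=> sx sy; rewrite /conjK -(sum_tuple_delta (fun u => R u (f y)) sx).
apply: eq_bigr => u _; rewrite -(sum_tuple_delta (fun v => R u v) sy) mulr_sumr.
by apply: eq_bigr => v _; rewrite rmorph_nat; ring.
Qed.

Lemma posK_ext n R R' : eqK n R R' -> posK n R -> posK n R'.
Proof.
move=> eR pR G x; have := pR G x; congr (0 <= _).
by apply: eq_bigr => u _; apply: eq_bigr => v _; rewrite eR ?size_tuple.
Qed.

Lemma posK_pull m n (f : seq bool -> seq bool) R :
  (forall x, size x = n -> size (f x) = m) ->
  posK m R -> posK n (fun x y => R (f x) (f y)).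
Proof.
move=> sf pR; apply: posK_ext (_ : posK n (conjK m (fun x u => (u == f x)%:R) R)).
  by move=> x y sx sy; rewrite conjK_pull ?sf.
by move=> G x; rewrite conjK_mul.
Qed.

Lemma posK_sum n (I : finType) (R : I -> kern C) :
  (forall i, posK n (R i)) -> posK n (fun x y => \sum_i R i x y).
Proof.
move=> pR G x; rewrite (_ : conjK _ _ _ _ _ = \sum_i conjK n G (R i) x x).
  by apply: sumr_ge0 => i _; apply: pR.
rewrite exchange_big; apply: eq_bigr => u _ /=.
rewrite exchange_big; apply: eq_bigr => v _ /=.
by rewrite mulr_sumr mulr_suml.
Qed.

Lemma posK_margl m n R : posK (m + n) R -> posK n (margl m R).
Proof.
move=> pR; apply: posK_sum => s; apply: (posK_pull (f := cat s)) pR => x sx.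
by rewrite size_cat size_tuple sx.
Qed.

Lemma posK_margr m n R : posK (n + m) R -> posK n (margr m R).
Proof.
move=> pR; apply: posK_sum => s; apply: (posK_pull (f := cat^~ s)) pR => x sx.
by rewrite size_cat size_tuple sx.
Qed.

Lemma posK_diag n R u : size u = n -> posK n R -> 0 <= R u u.
Proof. by move=> su pR; rewrite -(@conjK_pull n id R u u) //; exact: pR. Qed.

(** The hypothesis is positivity of the matrix with rows [0, a] and [b, d]. For [q = 1] and [p]
    scaled by a real [t] it reads [0 <= t * z + d] with [z = p * a + p^* * b], which forces [z = 0];
    then [p = 1] and [p = 'i] give [a + b = 0] and [a = b]. *)
Lemma pos_offdiag0 (a b d : C) :
  (forall p q : C, 0 <= p * q^* * a + q * p^* * b + q * q^* * d) -> a = 0 /\ b = 0.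
Proof.
move=> pos.
have d0 : 0 <= d by have := pos 0 1; rewrite conjC1 conjC0 !(mul0r, mulr0, mul1r) !add0r.
have lin0 p : p * a + p^* * b = 0.
  apply/eqP/negPn/negP => z0; set z := p * a + p^* * b in z0.
  have pos' t : t \is Num.real -> 0 <= t * z + d.
    move=> tR; have := pos (t * p) 1; rewrite rmorphM /= (CrealP tR) conjC1.
    by rewrite (_ : _ + _ = t * z + d) // /z; ring.
  (* [z + d] and [d] are nonnegative, so [z] is real and [- (d + 1) / z] is an admissible [t]; it
     yields the value [-1]. *)
  have zR : z \is Num.real.
    have := pos' 1 (real1 C); rewrite mul1r => /ger0_real zdR.
    by rewrite -[z](addrK d) rpredB // ger0_real.
  have tR : - (d + 1) / z \is Num.real.
    by rewrite rpredM ?rpredN ?rpredV // rpredD ?real1 // ger0_real.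
  have := pos' _ tR; rewrite divfK // (_ : _ + d = -1) ?ler0N1 //; ring.
have e1 := lin0 1; have e2 := lin0 'i.
move: e1 e2; rewrite conjC1 conjCi !mul1r mulNr -mulrBr => e1.
move/eqP; rewrite mulf_eq0 (negPf (neq0Ci C)) /= subr_eq0 => /eqP eab.
move: e1; rewrite eab -mulr2n => /eqP; rewrite mulrn_eq0 /= => /eqP b0.
by rewrite b0.
Qed.

Lemma posK_offdiag0 n R u v : size u = n -> size v = n -> u != v ->
  posK n R -> R u u = 0 -> R u v = 0 /\ R v u = 0.
Proof.
move=> su sv uv pR R0; apply: (pos_offdiag0 (d := R v v)) => p q.
(* The test vector is supported on [u] and [v]; all rows of this kernel are equal, so the empty row
   label serves. *)
have := pR (fun _ z => p * (z == u)%:R + q * (z == v)%:R) [::].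
congr (0 <= _); rewrite /conjK.
have lin (p1 q1 : C) F : \sum_(z : n.-tuple bool) (p1 * (tval z == u)%:R + q1 * (tval z == v)%:R) * F z
    = p1 * F u + q1 * F v.
  rewrite -(sum_tuple_delta F su) -(sum_tuple_delta F sv) !mulr_sumr -big_split /=.
  by apply: eq_bigr => z _; ring.
transitivity (\sum_(z : n.-tuple bool) (p * (tval z == u)%:R + q * (tval z == v)%:R) *
   (p^* * R z u + q^* * R z v)).
  apply: eq_bigr => z _; rewrite -(lin p^* q^* (R z)) mulr_sumr.
  by apply: eq_bigr => t _; rewrite rmorphD !rmorphM !rmorph_nat /=; ring.
rewrite (lin p q (fun z => p^* * R z u + q^* * R z v)) R0; ring.
Qed.
End Kernels.

Section Gates.
Variable C : numClosedFieldType.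
Implicit Types (T : bool -> bool -> C) (g G R : kern C) (n m : nat).

(** * The truth perspective as a change of basis *)

Lemma tensT_tensor T m n : tensorK m n (tensT T) (tensT T) (tensT T).
Proof.
move=> s t x y ss st sx sy; rewrite /tensT size_cat big_split_ord /=; congr (_ * _).
  by apply: eq_bigr => k _; rewrite !nth_cat st -ss ltn_ord.
apply: eq_bigr => k _; rewrite !nth_cat st ss; case: ltnP => [|_]; first lia.
by rewrite addKn.
Qed.

Lemma isomK0 (K : kern C) : K [::] [::] = 1 -> isomK 0 K.
Proof.
move=> K1 [|//] [|//] _ _.
by rewrite (sum_tuple0 (fun x => (K x [::])^* * K x [::])) K1 conjC1 mul1r.
Qed.

Lemma tensT_nil T : tensT T [::] [::] = 1.
Proof. by rewrite /tensT big_ord0. Qed.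

Lemma tensT1 T a b : tensT T [:: a] [:: b] = T a b.
Proof. by rewrite /tensT big_ord_recl big_ord0 mulr1. Qed.

Lemma tensT_isom T n : unitary2 T -> isomK n (tensT T).
Proof.
move=> [iT _]; elim: n => [|n IH]; first exact: isomK0 (tensT_nil T).
rewrite -add1n; apply: isomK_tensor (@tensT_tensor T 1 n) _ IH => -[|a []] // [|b []] // _ _.
rewrite (sum_tuple1 (fun x => (tensT T x [:: a])^* * tensT T x [:: b])).
under eq_bigr do rewrite !tensT1.
by rewrite iT eqseq_cons andbT.
Qed.

Definition adj2 T : bool -> bool -> C := fun i j => (T j i)^*.

Lemma unitary2_adj T : unitary2 T -> unitary2 (adj2 T).
Proof.
move=> [iT cT]; split=> i j; rewrite /adj2.
  by rewrite -cT; apply: eq_bigr => k _; rewrite conjCK.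
by rewrite -iT; apply: eq_bigr => k _; rewrite conjCK.
Qed.

Lemma tensT_adj T x u : size x = size u -> tensT (adj2 T) u x = (tensT T x u)^*.
Proof. by move=> sxu; rewrite /tensT sxu rmorph_prod. Qed.

Lemma gateT_mul T n g : eqK n (gateT T n g)
  (mulK n (tensT T) (mulK n g (tensT (adj2 T)))).
Proof.
move=> x y sx sy; apply: eq_bigr => u _; rewrite /mulK mulr_sumr.
by apply: eq_bigr => v _; rewrite tensT_adj ?size_tuple // mulrA.
Qed.

Lemma gateT_isom T n g : unitary2 T -> isomK n g -> isomK n (gateT T n g).
Proof.
move=> uT ig; apply: isomK_ext (_ : isomK n (mulK n (tensT T) (mulK n g (tensT (adj2 T))))).
  by move=> x y sx sy; rewrite gateT_mul.
apply: isomK_mul; first exact: tensT_isom.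
by apply: isomK_mul => //; apply/tensT_isom/unitary2_adj.
Qed.

Lemma adj_gateT T n g : unitary2 T ->
  eqK n (mulK n (tensT (adj2 T)) (gateT T n g)) (mulK n g (tensT (adj2 T))).
Proof.
move=> uT x y sx sy.
rewrite -(sum_tuple_delta (fun x => mulK n g (tensT (adj2 T)) x y) sx).
transitivity (\sum_(z : n.-tuple bool) \sum_(u : n.-tuple bool)
    (tensT T z x)^* * tensT T z u * mulK n g (tensT (adj2 T)) u y).
  apply: eq_bigr => z _; rewrite gateT_mul ?size_tuple // tensT_adj ?size_tuple //.
  by rewrite {1}/mulK mulr_sumr; apply: eq_bigr => u _; rewrite mulrA.
rewrite exchange_big; apply: eq_bigr => u _ /=.
by rewrite -mulr_suml tensT_isom ?size_tuple // eq_sym.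
Qed.

(** The matrix of [R] in the rotated basis [T|x_1> ... T|x_n>], where [gateT T n g] acts as plain
    [g]. *)
Definition basisK T n R : kern C := conjK n (tensT (adj2 T)) R.

Lemma basisK_gate T n g R : unitary2 T ->
  eqK n (basisK T n (conjK n (gateT T n g) R)) (conjK n g (basisK T n R)).
Proof.
move=> uT x y sx sy; rewrite /basisK !conjK_mul.
by apply: conjK_ext => //; apply: adj_gateT.
Qed.

(** Orthonormality of the rotated basis turns both inner sums into deltas. With [P] the last bit or
    its negation this computes the states of [Tt] and [Ff]. *)
Lemma basisK_proj T n (P : pred (seq bool)) x y : unitary2 T -> size x = n -> size y = n ->
  basisK T n (fun x y => \sum_(u : n.-tuple bool | P u) tensT T x u * (tensT T y u)^*) x y
  = ((x == y) && P x)%:R.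
Proof.
move=> uT sx sy.
transitivity (\sum_(u : n.-tuple bool) (tval u == x)%:R * ((x == y) && P u)%:R : C); last first.
  by rewrite (sum_tuple_delta (fun u => ((x == y) && P u)%:R)).
transitivity (\sum_(u : n.-tuple bool | P u)
   (\sum_(s : n.-tuple bool) (tensT T s x)^* * tensT T s u) *
   (\sum_(s : n.-tuple bool) (tensT T s u)^* * tensT T s y)).
  rewrite /basisK /conjK.
  under eq_bigr do under eq_bigr do rewrite mulr_sumr mulr_suml.
  under eq_bigr do rewrite exchange_big /=.
  rewrite exchange_big; apply: eq_bigr => u _ /=; rewrite big_distrlr /=.
  apply: eq_bigr => s _; apply: eq_bigr => t _.
  by rewrite !tensT_adj ?size_tuple // conjCK !mulrA.
rewrite big_mkcond; apply: eq_bigr => u _.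
rewrite !tensT_isom ?size_tuple //.
case: (P u); rewrite ?andbF ?mulr0 //= andbT -!natrM !mulnb.
by rewrite (eq_sym x u); case: eqP => //= ->.
Qed.

(** * Probabilities and the state of the last qubit *)

Lemma pT_basisK T n R :
  pT T n R = \sum_(u : n.-tuple bool | lastb u) basisK T n R u u.
Proof.
rewrite /pT /P1 /basisK /conjK; under eq_bigr do under eq_bigr do rewrite mulr_suml.
under eq_bigr do rewrite exchange_big /=.
rewrite exchange_big; apply: eq_bigr => u _ /=.
rewrite exchange_big; apply: eq_bigr => s _; apply: eq_bigr => t _ /=.
by rewrite !tensT_adj ?size_tuple // conjCK; ring.
Qed.

(* The state of the last qubit, expressed in the basis T|0>, T|1>. *)
Definition lastK T n R (c d : bool) : C := margl n.-1 (basisK T n R) [:: c] [:: d].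

Lemma lastb_rcons s c : lastb (rcons s c) = c.
Proof. exact: last_rcons. Qed.

Lemma init_rcons s c : init (rcons s c) = s.
Proof. by rewrite /init size_rcons /= -cats1 take_size_cat. Qed.

Lemma rcons_initK s n : size s = n.+1 -> rcons (init s) (lastb s) = s.
Proof. by case/lastP: s => // s c _; rewrite init_rcons lastb_rcons. Qed.

Lemma size_init s n : size s = n.+1 -> size (init s) = n.
Proof. by move=> ss; rewrite size_takel ss. Qed.

Lemma lastK_rcons T n R c d :
  lastK T n.+1 R c d = \sum_(w : n.-tuple bool) basisK T n.+1 R (rcons w c) (rcons w d).
Proof. by apply: eq_bigr => w _; rewrite !cats1. Qed.

Lemma pT_lastK T n R : (0 < n)%N -> pT T n R = lastK T n R true true.
Proof.
case: n => // n _; rewrite pT_basisK big_mkcond lastK_rcons.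
rewrite (sum_tuple_rcons _ (fun u => if lastb u then basisK T n.+1 R u u else 0)).
by apply: eq_bigr => w _; rewrite big_bool !lastb_rcons /= addr0.
Qed.

Lemma lastK_ext T n R R' c d : (0 < n)%N -> eqK n R R' ->
  lastK T n R c d = lastK T n R' c d.
Proof.
case: n => // n _ eR; rewrite !lastK_rcons; apply: eq_bigr => w _.
by apply: conjK_ext; rewrite ?size_rcons ?size_tuple.
Qed.

(** * Gates acting on the last bit only *)

(** The block-diagonal form shared by all five gates: the prefix is kept and selects the 2x2 matrix
    applied to the last bit. *)
Definition ctlK (h : seq bool -> bool -> bool -> C) : kern C := fun x y =>
  (init x == init y)%:R * h (init y) (lastb x) (lastb y).

Definition conj2 (h q : bool -> bool -> C) (c d : bool) : C :=
  \sum_(a : bool) \sum_(b : bool) h c a * q a b * (h d b)^*.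

Lemma ctlK_isom h n : (forall w a b, size w = n ->
    \sum_(c : bool) (h w c a)^* * h w c b = (a == b)%:R) -> isomK n.+1 (ctlK h).
Proof.
move=> ih u v su sv.
rewrite (sum_tuple_rcons _ (fun x => (ctlK h x u)^* * ctlK h x v)).
have siu := size_init su; have siv := size_init sv.
rewrite -(rcons_initK su) -(rcons_initK sv) eqseq_rcons.
set iu := init u in siu *; set iv := init v in siv *.
set a := lastb u; set b := lastb v.
transitivity (\sum_(x : n.-tuple bool) (tval x == iu)%:R * ((x == iv :> seq bool)%:R *
   \sum_(c : bool) (h iu c a)^* * h iv c b)).
  apply: eq_bigr => x _; rewrite !mulr_sumr; apply: eq_bigr => c _.
  by rewrite /ctlK !init_rcons !lastb_rcons rmorphM rmorph_nat; ring.
rewrite (sum_tuple_delta (fun x => (x == iv)%:R * \sum_(c : bool) (h iu c a)^* * h iv c b)) //.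
by case: eqP => [->|_]; rewrite ?mul0r // mul1r ih.
Qed.

(** Entries with a common prefix suffice, since only these occur in the trace over prefixes; they
    see the block of [w] alone. *)
Lemma conjK_ctl h n R w c d : size w = n ->
  conjK n.+1 (ctlK h) R (rcons w c) (rcons w d) =
  conj2 (h w) (fun a b => R (rcons w a) (rcons w b)) c d.
Proof.
move=> sw; rewrite /conj2 /conjK.
rewrite (sum_tuple_rcons _ (fun u => \sum_(v : n.+1.-tuple bool)
  ctlK h (rcons w c) u * R u v * (ctlK h (rcons w d) v)^*)).
rewrite -(sum_tuple_delta (fun s => \sum_(a : bool) \sum_(b : bool)
  h s c a * R (rcons s a) (rcons w b) * (h w d b)^*) sw).
apply: eq_bigr => s _; rewrite mulr_sumr; apply: eq_bigr => a _.
rewrite (sum_tuple_rcons _ (fun v =>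
  ctlK h (rcons w c) (rcons s a) * R (rcons s a) v * (ctlK h (rcons w d) v)^*)).
rewrite -(sum_tuple_delta (fun t => \sum_(b : bool)
  h s c a * R (rcons s a) (rcons t b) * (h t d b)^*) sw) mulr_sumr.
apply: eq_bigr => t _; rewrite !mulr_sumr; apply: eq_bigr => b _.
rewrite /ctlK !init_rcons !lastb_rcons rmorphM rmorph_nat.
by rewrite (eq_sym w s) (eq_sym w t); ring.
Qed.

Lemma lastK_gate T n g h R c d : unitary2 T -> eqK n.+1 g (ctlK h) ->
  lastK T n.+1 (conjK n.+1 (gateT T n.+1 g) R) c d =
  \sum_(w : n.-tuple bool)
     conj2 (h w) (fun a b => basisK T n.+1 R (rcons w a) (rcons w b)) c d.
Proof.
move=> uT eg; rewrite lastK_rcons; apply: eq_bigr => w _.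
rewrite -(conjK_ctl h (basisK T n.+1 R) c d (size_tuple w)) basisK_gate ?size_rcons ?size_tuple //.
by apply: conjK_ext; rewrite ?size_rcons ?size_tuple.
Qed.

(** A block that does not depend on the prefix comes out of the sum over prefixes, so the last qubit
    evolves on its own. *)
Lemma lastK_gate1 T n g h R c d : unitary2 T -> eqK n.+1 g (ctlK (fun=> h)) ->
  lastK T n.+1 (conjK n.+1 (gateT T n.+1 g) R) c d = conj2 h (lastK T n.+1 R) c d.
Proof.
move=> uT eg; rewrite (lastK_gate _ _ _ uT eg) /conj2.
rewrite exchange_big; apply: eq_bigr => a _ /=.
rewrite exchange_big; apply: eq_bigr => b _ /=.
by rewrite lastK_rcons mulr_sumr mulr_suml.
Qed.

(** * The 2x2 blocks of the gates and their unitarity *)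

Definition not2 (a b : bool) : C := (a == ~~ b)%:R.
Definition sqid2 (a b : bool) : C :=
  if a == b then (if b then -1 else 1) / sqrtC 2 else 1 / sqrtC 2.
Definition sqnot2 (a b : bool) : C := if a == b then (1 - 'i) / 2 else (1 + 'i) / 2.
(** The block of a controlled NOT: the last bit is flipped when [f] holds of the prefix, as in XOR
    and Toffoli. *)
Definition flip2 (f : seq bool -> bool) (w : seq bool) (a b : bool) : C :=
  (a == f w (+) b)%:R.

Lemma permK_ctl n (f : seq bool -> bool) (g : seq bool -> bool -> bool) :
  (forall s, size s = n.+1 -> f s = g (init s) (lastb s)) ->
  eqK n.+1 (permK C (fun s => rcons (init s) (f s))) (ctlK (fun w a b => (a == g w b)%:R)).
Proof.
move=> fg x y sx sy; rewrite /permK /ctlK -natrM mulnb -{1}(rcons_initK sx).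
by rewrite eqseq_rcons fg.
Qed.

Lemma notK_ctl n : eqK n.+1 (notK C) (ctlK (fun=> not2)).
Proof. exact: (permK_ctl (g := fun=> negb)). Qed.

Lemma nth_init s n k : size s = n.+1 -> (k < n)%N -> nth false s k = nth false (init s) k.
Proof. by move=> ss kn; rewrite nth_take // ss. Qed.

Lemma xorK_ctl n m : (m.-1 < n)%N ->
  eqK n.+1 (xorK C m) (ctlK (flip2 (fun w => nth false w m.-1))).
Proof.
move=> mn; apply: (permK_ctl (g := fun w => addb (nth false w m.-1))) => s ss.
by rewrite (nth_init ss).
Qed.

Lemma toffK_ctl n m p : (m.-1 < n)%N -> (p.-1 < n)%N ->
  eqK n.+1 (toffK C m p)
    (ctlK (flip2 (fun w => nth false w m.-1 && nth false w p.-1))).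
Proof.
move=> mn pn.
apply: (permK_ctl (g := fun w => addb (nth false w m.-1 && nth false w p.-1))) => s ss.
by rewrite !(nth_init ss).
Qed.

Lemma flip2_isom f w a b : \sum_(c : bool) (flip2 f w c a)^* * flip2 f w c b = (a == b)%:R.
Proof.
rewrite big_bool /flip2.
by case: (f w); case: a; case: b; rewrite /= ?(conjC0, conjC1, mulr0, mul0r, mulr1, addr0, add0r).
Qed.

Lemma not2_isom a b : \sum_(c : bool) (not2 c a)^* * not2 c b = (a == b)%:R.
Proof. by rewrite -(flip2_isom (fun=> true) [::]); case: a; case: b. Qed.

Lemma conj_sqrtCV2 : ((sqrtC 2)^-1)^* = (sqrtC 2)^-1 :> C.
Proof. by rewrite geC0_conj // invr_ge0 sqrtC_ge0 ler0n. Qed.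

Lemma sqrtCV2_sqr : (sqrtC 2)^-1 * (sqrtC 2)^-1 = 2^-1 :> C.
Proof. by rewrite -invfM -expr2 sqrtCK. Qed.

Lemma half_add : 2^-1 + 2^-1 = 1 :> C.
Proof. by field. Qed.

Lemma conj_sqid2 a b : (sqid2 a b)^* = sqid2 a b.
Proof.
rewrite /sqid2; case: a; case: b => /=;
by rewrite rmorphM ?rmorphN /= conj_sqrtCV2 ?rmorphN conjC1.
Qed.

(** Conjugation exchanges [(1 - 'i) / 2] and [(1 + 'i) / 2], the diagonal and off-diagonal
    entries. *)
Lemma conj_sqnot2 a b : (sqnot2 a b)^* = sqnot2 a (~~ b).
Proof.
have h2 : (2^-1 : C)^* = 2^-1 by rewrite fmorphV rmorph_nat.
rewrite /sqnot2; case: a; case: b => /=;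
by rewrite rmorphM /= h2 ?rmorphB ?rmorphD /= conjCi conjC1 ?opprK.
Qed.

Lemma sqid2_isom a b : \sum_(c : bool) (sqid2 c a)^* * sqid2 c b = (a == b)%:R.
Proof.
rewrite big_bool !conj_sqid2 /sqid2; have := sqrtCV2_sqr; have := half_add.
(* With the constants generalised, the goals are polynomial identities modulo [h + h = 1] and
   [r * r = h]. *)
move: (2^-1) ((sqrtC 2)^-1) => h r hh rr; case: a; case: b => /=; by ring: hh rr.
Qed.

Lemma sqnot2_isom a b : \sum_(c : bool) (sqnot2 c a)^* * sqnot2 c b = (a == b)%:R.
Proof.
rewrite big_bool !conj_sqnot2 /sqnot2; have := sqrCi C; have := half_add.
move: (2^-1) 'i => h i hh ii; case: a; case: b => /=; by ring: hh ii.
Qed.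

Lemma sqidK_ctl n : eqK n.+1 (sqidK C) (ctlK (fun=> sqid2)). Proof. by []. Qed.
Lemma sqnotK_ctl n : eqK n.+1 (sqnotK C) (ctlK (fun=> sqnot2)). Proof. by []. Qed.

Lemma ctlK_gate_isom T n g h : unitary2 T -> eqK n.+1 g (ctlK h) ->
  (forall w a b, \sum_(c : bool) (h w c a)^* * h w c b = (a == b)%:R) ->
  isomK n.+1 (gateT T n.+1 g).
Proof.
move=> uT eg ih; apply: gateT_isom => //.
apply: isomK_ext (ctlK_isom (fun w a b _ => ih w a b)) => x y sx sy.
by rewrite eg.
Qed.

Lemma At_gt0 f : (0 < At f)%N.
Proof. by elim: f => //= *; lia. Qed.

Lemma compK_isom T f : unitary2 T -> isomK (At f) (compK T f).
Proof.
have id_isom n : isomK n (fun x y => (x == y)%:R : C).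
  move=> u v su sv; rewrite -(sum_tuple_delta (fun x => (x == v)%:R) su).
  by apply: eq_bigr => x _; rewrite rmorph_nat.
move=> uT; case: f => [p|||f|f|f|f f'|f f' f''] /=.
1-3: exact: id_isom.
1-3: have := At_gt0 f; case: (At f) => // n _.
- exact: ctlK_gate_isom uT (@notK_ctl n) (fun=> not2_isom).
- exact: ctlK_gate_isom uT (@sqidK_ctl n) (fun=> sqid2_isom).
- exact: ctlK_gate_isom uT (@sqnotK_ctl n) (fun=> sqnot2_isom).
- have := At_gt0 f; have := At_gt0 f'; case: (At f') => // n _ m0; rewrite addnS.
  by apply: ctlK_gate_isom uT (xorK_ctl _) (flip2_isom _); lia.
- have := At_gt0 f; have := At_gt0 f'; have := At_gt0 f''.
  case: (At f'') => // n _ m0 p0; rewrite addnS.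
  by apply: ctlK_gate_isom uT (toffK_ctl _ _) (flip2_isom _); lia.
Qed.

End Gates.

(** * Levels of the syntactical tree and occurrences *)

Definition Ats (l : seq qform) : nat := sumn (map At l).

Lemma Ats_cat l1 l2 : Ats (l1 ++ l2) = (Ats l1 + Ats l2)%N.
Proof. by rewrite /Ats map_cat sumn_cat. Qed.

Lemma step_cat l1 l2 : step (l1 ++ l2) = step l1 ++ step l2.
Proof. by rewrite /step map_cat flatten_cat. Qed.

(** Expansion keeps the number of atoms of each entry, so all levels of a tree live on one space and
    are cut at the same places. *)
Lemma Ats_step l : Ats (step l) = Ats l.
Proof.
elim: l => // f l IH; rewrite -cat1s step_cat !Ats_cat IH /step /=.
by case: f => * /=; rewrite /Ats /= !addn0 ?addnA.
Qed.

Lemma levelS g i : (0 < i)%N -> level g i.+1 = step (level g i).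
Proof. by case: i. Qed.

Lemma Ats_level g i : Ats (level g i) = At g.
Proof. by rewrite /level; elim: i.-1 => [|k IH] /=; rewrite ?Ats_step // /Ats /= addn0. Qed.

Lemma is_atomic_depth f : (depth f <= 0)%N -> is_atomic f.
Proof. by case: f. Qed.

Lemma iter_step_atomic k l :
  all (fun f => (depth f <= k)%N) l -> all is_atomic (iter k step l).
Proof.
elim: k l => [|k IH] l dl; first by apply: sub_all dl => f; apply: is_atomic_depth.
rewrite iterSr; apply: IH; elim: l dl => // f l IHl /= /andP[df /IHl dl].
rewrite -[f :: l]cat1s step_cat all_cat dl andbT /step /= cats0.
by case: f df => //= *; rewrite ?andbT; lia.
Qed.

Lemma occ_split g b i j : occ g b i j ->
  exists l1 l2, level g i = l1 ++ b :: l2 /\ j = size l1.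
Proof.
move=> [_ [jl <-]]; exists (take j (level g i)), (drop j.+1 (level g i)).
by rewrite -drop_nth // cat_take_drop size_takel // ltnW.
Qed.

Lemma occ_cat g b i l1 l2 : (1 <= i <= height g)%N ->
  level g i = l1 ++ b :: l2 -> occ g b i (size l1).
Proof.
by move=> ih lE; split=> //; rewrite lE size_cat /= nth_cat ltnn subnn; split=> //; lia.
Qed.

(** The last level is all atoms, so there is a next level to which the model equation relates this
    one. *)
Lemma occ_nonatomic g b i j : occ g b i j -> ~~ is_atomic b -> (1 <= i < height g)%N.
Proof.
move=> [/andP[i1 ih] [jl <-]] nb; rewrite i1 ltn_neqAle ih andbT.
apply: contraNneq nb => iE; apply: all_nthP jl.
by rewrite iE /level /height /=; apply: iter_step_atomic; rewrite /= leqnn.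
Qed.

(** * Splitting labels into blocks *)

Lemma size_chunks ns (s : seq bool) : size (chunks ns s) = size ns.
Proof. by elim: ns s => //= k ns IH s; rewrite IH. Qed.

Lemma chunks_cat ns1 ns2 (s1 s2 : seq bool) : size s1 = sumn ns1 ->
  chunks (ns1 ++ ns2) (s1 ++ s2) = chunks ns1 s1 ++ chunks ns2 s2.
Proof.
elim: ns1 s1 => [|k ns1 IH] s1 /= ss; first by rewrite (size0nil ss).
have ks : (k <= size s1)%N by lia.
rewrite take_cat drop_cat; case: ltnP => [_|sk].
  by rewrite IH // size_drop ss addKn.
have -> : k = size s1 by lia.
rewrite subnn take0 drop0 take_size drop_size cats0 -(IH [::]) //=; lia.
Qed.

Lemma flatten_chunks ns (s : seq bool) : size s = sumn ns -> flatten (chunks ns s) = s.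
Proof.
elim: ns s => [|k ns IH] s /= ss; first by rewrite (size0nil ss).
by rewrite IH ?cat_take_drop // size_drop ss addKn.
Qed.

(** [red] compares labels block by block; this turns the comparison into equality of labels. *)
Lemma chunks_inj ns (s t : seq bool) : size s = sumn ns -> size t = sumn ns ->
  (forall k, (k < size ns)%N -> nth [::] (chunks ns s) k = nth [::] (chunks ns t) k) ->
  s = t.
Proof.
move=> ss st e; rewrite -(flatten_chunks ss) -(flatten_chunks st); congr flatten.
by apply: (@eq_from_nth _ [::]) => [|k]; rewrite !size_chunks // => /e.
Qed.

Section Models.
Variable C : numClosedFieldType.
Implicit Types (T : bool -> bool -> C) (Hol : hol_map C).

(** * Reduced states as two-sided partial traces *)

(** Sequences of the wrong length are read as the all-[false] label, a default that [eqK n] never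
    inspects. *)
Definition kop n (rho : op C n) : kern C := fun x y =>
  rho (insubd [tuple of nseq n false] x) (insubd [tuple of nseq n false] y).

Lemma kopE n (rho : op C n) (x y : n.-tuple bool) : kop rho x y = rho x y.
Proof. by rewrite /kop !valKd. Qed.

Lemma eqK_tuple n (A B : kern C) :
  (forall x y : n.-tuple bool, A x y = B x y) -> eqK n A B.
Proof.
move=> e x y /eqP sx /eqP sy; exact: (e (Tuple sx) (Tuple sy)).
Qed.

Lemma kop_apply n (G : kern C) (rho : op C n) :
  eqK n (kop (applyK G rho)) (conjK n G (kop rho)).
Proof.
apply: eqK_tuple => x y; rewrite kopE; apply: eq_bigr => u _; apply: eq_bigr => v _.
by rewrite kopE.
Qed.

Lemma kop_pos n (rho : op C n) : density rho -> posK n (kop rho).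
Proof.
(* [conjK] has the row of [G] unconjugated on the left, so the test vector is its conjugate. *)
move=> [pos _] G x; have := pos (fun u => (G x u)^*); congr (0 <= _).
by apply: eq_bigr => u _; apply: eq_bigr => v _; rewrite kopE conjCK.
Qed.

Definition margK m n (R : kern C) : kern C := margr n (margl m R).

(** With labels cut into left part, chosen block and right part, the selection in [red] is a product
    of deltas, and only the sums over the two outer parts survive. *)
Lemma red_margK N ns1 k ns2 (rho : op C N) : N = (sumn ns1 + (k + sumn ns2))%N ->
  eqK k (red (ns1 ++ k :: ns2) (size ns1) rho) (margK (sumn ns1) (sumn ns2) (kop rho)).
Proof.
move=> NE a b sa sb; rewrite /red.
under eq_bigr do under eq_bigr do rewrite -kopE.
move: (kop rho) => R {rho}; subst N.
set ns := ns1 ++ k :: ns2.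
set P := fun x y => (nth [::] (chunks ns x) (size ns1) == a)
  && (nth [::] (chunks ns y) (size ns1) == b)
  && [forall i : 'I_(size ns), (i != size ns1 :> nat) ==>
        (nth [::] (chunks ns x) i == nth [::] (chunks ns y) i)].
have PE s u t s' u' t' : size s = sumn ns1 -> size s' = sumn ns1 ->
    size u = k -> size u' = k -> size t = sumn ns2 -> size t' = sumn ns2 ->
    P (s ++ (u ++ t)) (s' ++ (u' ++ t')) =
    (u == a) && (u' == b) && ((s' == s) && (t' == t)).
  move=> ss ss' su su' st st'; rewrite /P /ns !chunks_cat //= !take_size_cat //.
  rewrite !drop_size_cat // !nth_cat !size_chunks ltnn subnn /=; congr (_ && _).
  apply/forallP/andP => [e|[/eqP-> /eqP->] [i ilt] /=]; last first.
    rewrite !nth_cat !size_chunks; case: ltngtP => //= ilt1.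
    by rewrite -[(i - size ns1)%N]prednK ?subn_gt0 //= eqxx.
  have e' i : (i < size ns)%N -> i != size ns1 ->
     nth [::] (chunks ns1 s ++ u :: chunks ns2 t) i =
     nth [::] (chunks ns1 s' ++ u' :: chunks ns2 t') i.
    by move=> ilt ine; apply/eqP; move: (e (Ordinal ilt)) => /= /implyP; apply.
  have sns : size ns = (size ns1 + (size ns2).+1)%N by rewrite size_cat.
  split; apply/eqP; symmetry.
    apply: (chunks_inj (ns := ns1)) => // i ilt.
    have := e' i; rewrite !nth_cat !size_chunks ilt; apply; lia.
  apply: (chunks_inj (ns := ns2)) => // i ilt.
  (* Block [i] of the right part comes after the blocks of [ns1] and the chosen block, hence the
     successor. *)
  have := e' (size ns1 + i.+1)%N; rewrite !nth_cat !size_chunks.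
  by rewrite (_ : (_ < size ns1)%N = false) ?addKn /=; [apply; lia | lia].
transitivity (\sum_(x : (sumn ns1 + (k + sumn ns2)).-tuple bool)
  \sum_(y : (sumn ns1 + (k + sumn ns2)).-tuple bool) (P x y)%:R * R x y) => //.
rewrite (sum_tuple_cat _ _ (fun x => \sum_(y : (sumn ns1 + (k + sumn ns2)).-tuple bool)
  (P x y)%:R * R x y)).
rewrite /margK /margr /margl [RHS]exchange_big; apply: eq_bigr => s _ /=.
rewrite (sum_tuple_cat _ _ (fun x => \sum_(y : (sumn ns1 + (k + sumn ns2)).-tuple bool)
  (P (s ++ x) y)%:R * R (s ++ x) y)).
rewrite exchange_big; apply: eq_bigr => t _ /=.
(* Four deltas, for [u], [s'], [u'] and [t'], are inserted in turn to match the factors given by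
   [PE]. *)
rewrite -(sum_tuple_delta (fun u => R (s ++ (u ++ t)) (s ++ (b ++ t))) sa).
apply: eq_bigr => u _.
rewrite (sum_tuple_cat _ _ (fun y => (P (s ++ (u ++ t)) y)%:R * R (s ++ (u ++ t)) y)).
rewrite -(sum_tuple_delta (fun s' => R (s ++ (u ++ t)) (s' ++ (b ++ t))) (size_tuple s)).
rewrite mulr_sumr; apply: eq_bigr => s' _.
rewrite (sum_tuple_cat _ _ (fun y => (P (s ++ (u ++ t)) (s' ++ y))%:R
   * R (s ++ (u ++ t)) (s' ++ y))).
rewrite -(sum_tuple_delta (fun u' => R (s ++ (u ++ t)) (s' ++ (u' ++ t))) sb) !mulr_sumr.
apply: eq_bigr => u' _.
rewrite -(sum_tuple_delta (fun t' => R (s ++ (u ++ t)) (s' ++ (u' ++ t'))) (size_tuple t)).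
rewrite !mulr_sumr; apply: eq_bigr => t' _.
rewrite PE ?size_tuple // -!mulnb !natrM; ring.
Qed.

Lemma cmean_margK Hol g i l1 b l2 : level g i = l1 ++ b :: l2 ->
  eqK (At b) (cmean Hol g i (size l1)) (margK (Ats l1) (Ats l2) (kop (Hol g i))).
Proof.
move=> lE; rewrite /cmean lE map_cat -(size_map At l1); apply: red_margK.
by rewrite -(Ats_level g i) lE Ats_cat.
Qed.

(** * Level gates as tensor products of isometries *)

Lemma levelK_cons T b l :
  tensorK (At b) (Ats l) (levelK T (b :: l)) (compK T b) (levelK T l).
Proof.
move=> s t x y ss st sx sy; rewrite /levelK big_ord_recl /=.
by rewrite !take_size_cat // !drop_size_cat.
Qed.

Lemma levelK_nil T x y : levelK T [::] x y = 1.
Proof. by rewrite /levelK big_ord0. Qed.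

Lemma levelK_cat T l1 l2 :
  tensorK (Ats l1) (Ats l2) (levelK T (l1 ++ l2)) (levelK T l1) (levelK T l2).
Proof.
elim: l1 => [|b l1 IH] s t x y ss st sx sy.
  by rewrite (size0nil ss) (size0nil st) levelK_nil mul1r.
rewrite /Ats /= in ss st.
rewrite -(cat_take_drop (At b) s) -(cat_take_drop (At b) t) -!catA cat_cons.
have tk (z : seq bool) : size z = (At b + Ats l1)%N -> size (take (At b) z) = At b.
  by move=> sz; rewrite size_takel // sz leq_addr.
have dr (z : seq bool) : size z = (At b + Ats l1)%N -> size (drop (At b) z) = Ats l1.
  by move=> sz; rewrite size_drop sz addKn.
by rewrite !levelK_cons ?IH ?size_cat ?Ats_cat ?tk ?dr ?sx ?sy // mulrA.
Qed.

Lemma levelK_isom T l : unitary2 T -> isomK (Ats l) (levelK T l).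
Proof.
move=> uT; elim: l => [|b l IH]; first exact/isomK0/levelK_nil.
exact: isomK_tensor (@levelK_cons T b l) (@compK_isom _ T b uT) IH.
Qed.

(** * Contextual meanings in a fixed model and tree *)

Section Context.
Variables (T : bool -> bool -> C) (Hol : hol_map C) (g : qform).
Arguments Hol : clear implicits.
Hypotheses (uT : unitary2 T) (hol : holistic T Hol).

(** The level gate factors over [l1], [b] and [l2]; its outer factors are isometries and vanish
    under the two partial traces. *)
Lemma margK_step i l1 b l2 : (1 <= i < height g)%N -> level g i = l1 ++ b :: l2 ->
  eqK (At b) (margK (Ats l1) (Ats l2) (kop (Hol g i)))
    (conjK (At b) (compK T b) (margK (Ats l1) (Ats l2) (kop (Hol g i.+1)))).
Proof.
move=> ih lE x y sx sy; have [_ [/(_ g i ih) -> _]] := hol.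
rewrite -(margr_conj _ (@levelK_cons T b l2) (@levelK_isom T l2 uT)) //.
apply: margr_ext sx sy; rewrite -[(At b + Ats l2)%N]/(Ats (b :: l2)) => u v su sv.
 rewrite -(margl_conj _ (@levelK_cat T l1 (b :: l2)) (@levelK_isom T l1 uT)) //.
apply: margl_ext su sv; rewrite -Ats_cat -lE Ats_level; exact: kop_apply.
Qed.

Lemma cmean_unary b c i j : expand b = [:: c] -> ~~ is_atomic b -> occ g b i j ->
  exists j', occ g c i.+1 j' /\
    eqK (At b) (cmean Hol g i j) (conjK (At b) (compK T b) (cmean Hol g i.+1 j')).
Proof.
move=> bc nb ob; have ih := occ_nonatomic ob nb.
have [l1 [l2 [lE ->]]] := occ_split ob.
have lE' : level g i.+1 = step l1 ++ c :: step l2.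
  by rewrite levelS ?lE; [rewrite -cat1s !step_cat /step /= bc | case/andP: ih].
have Abc : At b = At c by have := Ats_step [:: b]; rewrite /step /= bc /Ats /= !addn0.
exists (size (step l1)); split; first by apply: occ_cat lE'; lia.
move=> x y sx sy; rewrite (cmean_margK _ lE) // (margK_step ih lE) //.
apply: conjK_ext sx sy => // u v su sv; rewrite (cmean_margK _ lE') -?Abc //.
by rewrite !Ats_step.
Qed.

(** The occurrence is existential, so a connective can be unfolded at whichever occurrence the tree
    provides; normality makes [q] unique. *)
Definition last_state b (q : bool -> bool -> C) := exists i j, occ g b i j /\
  forall c d, lastK T (At b) (cmean Hol g i j) c d = q c d.

Lemma last_state_uniq b q q' : last_state b q -> last_state b q' ->
  forall c d, q c d = q' c d.
Proof.
move=> [i [j [oij e]]] [i' [j' [oij' e']]] c d; rewrite -e -e'.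
apply: lastK_ext (At_gt0 b) _; apply: eqK_tuple.
by have [_ [_ [norm _]]] := hol; apply: norm.
Qed.

Lemma last_state_unary b c k h q : expand b = [:: c] -> ~~ is_atomic b -> At b = At c ->
  compK T b = gateT T (At c) k ->
  (forall n, eqK n.+1 k (ctlK (fun=> h))) -> last_state b q ->
  exists q', last_state c q' /\ forall x y, q x y = conj2 h q' x y.
Proof.
move=> bc nb Abc bk kh [i [j [ob e]]].
have [j' [oc ej]] := cmean_unary bc nb ob.
exists (lastK T (At c) (cmean Hol g i.+1 j')); split; first by exists i.+1, j'.
move=> x y; rewrite -e (lastK_ext _ _ _ (At_gt0 b) ej) bk Abc.
by have := At_gt0 c; case: (At c) => // n _; apply: lastK_gate1.
Qed.

Lemma last_state_neg b q : last_state (Neg b) q ->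
  exists q', last_state b q' /\ forall x y, q x y = conj2 (@not2 C) q' x y.
Proof. by apply: last_state_unary => //; apply: notK_ctl. Qed.

Lemma last_state_sqid b q : last_state (Sqid b) q ->
  exists q', last_state b q' /\ forall x y, q x y = conj2 (@sqid2 C) q' x y.
Proof. by apply: last_state_unary => //; apply: sqidK_ctl. Qed.

Lemma last_state_sqneg b q : last_state (Sqneg b) q ->
  exists q', last_state b q' /\ forall x y, q x y = conj2 (@sqnot2 C) q' x y.
Proof. by apply: last_state_unary => //; apply: sqnotK_ctl. Qed.

Lemma lastK1 R c d : lastK T 1 R c d = basisK T 1 R [:: c] [:: d].
Proof. by rewrite /lastK /margl (sum_tuple0 (fun s => basisK T 1 R (s ++ [:: c]) (s ++ [:: d]))). Qed.

Lemma last_state_Ff q : last_state Ff q -> forall c d, q c d = ((c == d) && ~~ c)%:R.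
Proof.
move=> [i [j [o e]]] c d; rewrite -e; have [_ [_ [_ [ff _]]]] := hol.
rewrite (lastK_ext _ _ _ (At_gt0 Ff) (eqK_tuple (ff _ _ _ o))) lastK1.
by rewrite (basisK_proj (n := 1) (fun u => ~~ lastb u)) // eqseq_cons andbT.
Qed.

Lemma last_state_Tt q : last_state Tt q -> forall c d, q c d = ((c == d) && c)%:R.
Proof.
move=> [i [j [o e]]] c d; rewrite -e; have [_ [_ [_ [_ tt]]]] := hol.
rewrite (lastK_ext _ _ _ (At_gt0 Tt) (eqK_tuple (tt _ _ _ o))) lastK1.
by rewrite (basisK_proj (n := 1) lastb) // eqseq_cons andbT.
Qed.

Lemma conj2_flip2 f w (q : bool -> bool -> C) c d :
  conj2 (flip2 C f w) q c d = q (f w (+) c) (f w (+) d).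
Proof.
rewrite /conj2 !big_bool /flip2 !rmorph_nat.
by case: (f w); case: c; case: d; rewrite /= !(mulr0, mul0r, mulr1, mul1r, addr0, add0r).
Qed.

(* The target qubit of the Toffoli gate is in the pure state P0, so by positivity
   the joint state vanishes as soon as the target bit of a row or a column is 1;
   conditional flips of the target then create no coherence in it. *)
Lemma last_state_conjf a b q : last_state (conjf a b) q ->
  [/\ q true false = 0, q false true = 0 & q true true = 1 - q false false].
Proof.
move=> [i [j [ob e]]]; have ih := occ_nonatomic ob isT.
have [l1 [l2 [lE jE]]] := occ_split ob.
(* [N] counts the qubits of the two conjuncts; the atom [Ff] contributes the single target qubit
   after them. *)
set N := (At a + At b)%N.
have AN : At (conjf a b) = N.+1 by rewrite /= addn1.
have lE' : level g i.+1 = (step l1 ++ [:: a; b]) ++ Ff :: step l2.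
  by rewrite levelS ?lE; [rewrite -cat1s !step_cat /step /= -catA | case/andP: ih].
have off : occ g Ff i.+1 (size (step l1 ++ [:: a; b])) by apply: occ_cat lE'; lia.
(* The joint state of [a], [b] and [Ff] before the Toffoli gate; [W] is its matrix in the rotated
   basis. *)
set M := margK (Ats l1) (Ats l2) (kop (Hol g i.+1)).
set W := basisK T N.+1 M.
have Wff c d : \sum_(w : N.-tuple bool) W (rcons w c) (rcons w d) = ((c == d) && ~~ c)%:R.
  rewrite -(@last_state_Ff (lastK T 1 (cmean Hol g i.+1 (size (step l1 ++ [:: a; b])))));
    last by exists i.+1, (size (step l1 ++ [:: a; b])).
  have eM : eqK 1 (cmean Hol g i.+1 (size (step l1 ++ [:: a; b]))) (margl N M).
    move=> x y sx sy; rewrite (cmean_margK _ lE') //.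
    rewrite /M /margK margl_margr Ats_step; apply: margr_ext sx sy => u v _ _.
    by rewrite Ats_cat Ats_step -[Ats [:: a; b]]/(At a + (At b + 0))%N addn0 margl_add.
  rewrite (lastK_ext _ _ _ _ eM) // lastK1.
  (* Tracing out the conjuncts commutes with the change of basis, because [adj2 T] is unitary
     too. *)
  have := @margl_conj _ N 1 _ _ _ M (@tensT_tensor _ (adj2 T) N 1)
      (tensT_isom (unitary2_adj uT)) [:: c] [:: d] erefl erefl.
  rewrite /basisK => <-; apply: eq_bigr => w _.
  by rewrite /W /basisK addn1 !cats1.
have pW : posK N.+1 W.
  apply: posK_conj; apply: posK_margr; apply: posK_margl.
  suff -> : (Ats l1 + (N.+1 + Ats l2))%N = At g.
    by apply: kop_pos; have [dens _] := hol; apply: dens; lia.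
  by rewrite -AN -(Ats_level g i) lE Ats_cat.
(* These diagonal entries are nonnegative and sum to 0 by [Wff]. *)
have W11 (w : N.-tuple bool) : W (rcons w true) (rcons w true) = 0.
  have sW : \sum_(w : N.-tuple bool) W (rcons w true) (rcons w true) = 0 by rewrite Wff.
  apply: (psumr_eq0P _ sW) => // v _.
  by apply: posK_diag pW; rewrite size_rcons size_tuple.
have W0 (w : N.-tuple bool) c : W (rcons w c) (rcons w (~~ c)) = 0.
  have [||||h1 h2] := posK_offdiag0 (n := N.+1) (u := rcons w true) (v := rcons w false) _ _ _ pW.
  - by rewrite size_rcons size_tuple.
  - by rewrite size_rcons size_tuple.
  - by rewrite eqseq_rcons andbF.
  - exact: W11.
  by case: c.
have qE c d : q c d = \sum_(w : N.-tuple bool)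
   let f := nth false w (At a).-1 && nth false w N.-1 in
     W (rcons w (f (+) c)) (rcons w (f (+) d)).
  have := At_gt0 a; have := At_gt0 b => a0 b0.
  have eC : eqK N.+1 (cmean Hol g i j) (conjK N.+1 (gateT T N.+1 (toffK C (At a) N)) M).
    move=> x y sx sy; rewrite jE (cmean_margK _ lE) ?AN // (margK_step ih lE) ?AN //.
    by rewrite /= addn1.
  rewrite -e AN (lastK_ext _ _ _ _ eC) //.
  rewrite (lastK_gate _ _ _ uT (@toffK_ctl _ N (At a) N _ _)); try by rewrite /N; lia.
  by apply: eq_bigr => w _; rewrite conj2_flip2.
split.
- by rewrite qE big1 // => w _ /=; case: (_ && _); rewrite /= (W0 w).
- by rewrite qE big1 // => w _ /=; case: (_ && _); rewrite /= (W0 w).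
(* The controlled flip at most swaps the two diagonal entries of a prefix, so the trace is that of
   [W], which is 1 by [Wff]. *)
suff <- : q true true + q false false = 1 by rewrite addrK.
have <- : \sum_(w : N.-tuple bool) (W (rcons w true) (rcons w true)
    + W (rcons w false) (rcons w false)) = 1.
  by rewrite big_split /= !Wff add0r.
rewrite !qE -big_split; apply: eq_bigr => w _ /=.
by case: (_ && _) => //=; rewrite addrC.
Qed.

End Context.

(** Both consequences follow from one equality of probabilities, each being the [true true] entry of
    a last-qubit state. *)
Lemma lequiv_last_state a b :
  (forall T Hol g qa qb, unitary2 T -> holistic T Hol ->
     last_state T Hol g a qa -> last_state T Hol g b qb -> qa true true = qb true true) ->
  lequiv C a b.
Proof.
move=> e.
have pE T g Hol i j i' j' : unitary2 T -> holistic T Hol -> occ g a i j -> occ g b i' j' ->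
    pT T (At a) (cmean Hol g i j) = pT T (At b) (cmean Hol g i' j').
  move=> uT hol oa ob; rewrite !pT_lastK ?At_gt0 //.
  by apply: (e T Hol g) => //; [exists i, j | exists i', j'].
split=> T uT g _ _ Hol hol i j i' j' o o'.
  by rewrite (pE _ _ _ _ _ _ _ uT hol o o').
by rewrite (pE _ _ _ _ _ _ _ uT hol o' o).
Qed.
End Models.

(** * The unary connectives on 2x2 states *)

Section Qubit.
Variable C : numClosedFieldType.
Implicit Types q : bool -> bool -> C.

Lemma conj2_not q c d : conj2 (@not2 C) q c d = q (~~ c) (~~ d).
Proof.
rewrite /conj2 !big_bool /not2 !rmorph_nat.
by case: c; case: d; rewrite /= !(mulr0, mul0r, mulr1, mul1r, addr0, add0r).
Qed.

(** Conjugation by the Hadamard matrix. A diagonal state of trace 1 gets both diagonal entries equal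
    to 1/2. *)
Lemma conj2_sqid q c d : conj2 (@sqid2 C) q c d =
  (q false false + (-1) ^+ d * q false true
   + (-1) ^+ c * (q true false + (-1) ^+ d * q true true)) / 2.
Proof.
rewrite /conj2 !big_bool !conj_sqid2 /sqid2 -sqrtCV2_sqr.
by case: c; case: d => /=; ring.
Qed.

(** Here too a diagonal state of trace 1 gets both diagonal entries equal to 1/2. *)
Lemma conj2_sqnot q c d : conj2 (@sqnot2 C) q c d =
  (q c d + q (~~ c) (~~ d) + 'i * (q (~~ c) d - q c (~~ d))) / 2.
Proof.
rewrite /conj2 !big_bool !conj_sqnot2 /sqnot2; have := sqrCi C; move: 'i => i ii.
by case: c; case: d => /=; field: ii.
Qed.

End Qubit.

(** * The equivalences, item by item *)

Theorem theorem5p3 (C : numClosedFieldType) (a b : qform) :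
  lequiv C (Sqid (Sqid a)) a /\
  lequiv C (Sqid Ff) (Sqid Tt) /\
  (lequiv C (Neg (Sqid Ff)) (Sqid Ff) /\ lequiv C (Neg (Sqid Tt)) (Sqid Tt)) /\
  lequiv C (Sqid (conjf a b)) (Sqid Ff) /\
  lequiv C (Sqneg (Sqneg a)) (Neg a) /\
  lequiv C (Sqneg Ff) (Sqneg Tt) /\
  (lequiv C (Neg (Sqneg Ff)) (Sqneg Ff) /\ lequiv C (Neg (Sqneg Tt)) (Sqneg Tt)) /\
  lequiv C (Neg (Sqneg a)) (Sqneg (Neg a)) /\
  lequiv C (Sqneg (conjf a b)) (Sqneg Ff) /\
  lequiv C (Sqid (Sqneg a)) (Sqid a) /\
  lequiv C (Sqneg (Sqid a)) (Neg (Sqneg a)) /\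
  lequiv C (Sqid (Sqneg (conjf a b))) (Sqneg Ff) /\
  lequiv C (Sqneg (Sqid (conjf a b))) (Sqneg Ff).
Proof.
have ii := sqrCi C.
(* In each item both formulas are unfolded to shared subformulas, identified by [last_state_uniq],
   or to [Ff], [Tt] and conjunctions, whose states are constrained. *)
repeat match goal with |- _ /\ _ => split end;
  apply: lequiv_last_state => T Hol g p q uT hol sp sq.
- have [p1 [/(last_state_sqid uT hol)[p2 [sp2 p1E]] pE]] := last_state_sqid uT hol sp.
  by rewrite pE conj2_sqid !p1E !conj2_sqid -(last_state_uniq hol sp2 sq) /=; field.
- have [p1 [sp1 pE]] := last_state_sqid uT hol sp.
  have p1E := last_state_Ff uT hol sp1.
  have [q1 [sq1 qE]] := last_state_sqid uT hol sq.
  have q1E := last_state_Tt uT hol sq1.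
  by rewrite pE qE !conj2_sqid !p1E !q1E /=; field.
- have [p1 [sp1 pE]] := last_state_neg uT hol sp.
  have [q1 [sq1 qE]] := last_state_sqid uT hol sq.
  have q1E := last_state_Ff uT hol sq1.
  (* The negated formula is the right-hand side itself; its two diagonal entries are both 1/2. *)
  by rewrite pE conj2_not (last_state_uniq hol sp1 sq) !qE !conj2_sqid !q1E /=; field.
- have [p1 [sp1 pE]] := last_state_neg uT hol sp.
  have [q1 [sq1 qE]] := last_state_sqid uT hol sq.
  have q1E := last_state_Tt uT hol sq1.
  by rewrite pE conj2_not (last_state_uniq hol sp1 sq) !qE !conj2_sqid !q1E /=; field.
- have [p1 [sp1 pE]] := last_state_sqid uT hol sp.
  have [p10 p01 p11] := last_state_conjf uT hol sp1.
  have [q1 [sq1 qE]] := last_state_sqid uT hol sq.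
  have q1E := last_state_Ff uT hol sq1.
  by rewrite pE qE !conj2_sqid !q1E p10 p01 p11 /=; field.
- have [p1 [/(last_state_sqneg uT hol)[p2 [sp2 p1E]] pE]] := last_state_sqneg uT hol sp.
  have [q1 [sq1 qE]] := last_state_neg uT hol sq.
  rewrite pE qE conj2_sqnot conj2_not !p1E !conj2_sqnot -(last_state_uniq hol sp2 sq1) /=.
  (* ['i] becomes a variable subject only to [i ^+ 2 = -1]. *)
  by move: 'i ii => i ii; field: ii.
- have [p1 [sp1 pE]] := last_state_sqneg uT hol sp.
  have p1E := last_state_Ff uT hol sp1.
  have [q1 [sq1 qE]] := last_state_sqneg uT hol sq.
  have q1E := last_state_Tt uT hol sq1.
  by rewrite pE qE !conj2_sqnot !p1E !q1E /=; field.
- have [p1 [sp1 pE]] := last_state_neg uT hol sp.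
  have [q1 [sq1 qE]] := last_state_sqneg uT hol sq.
  have q1E := last_state_Ff uT hol sq1.
  by rewrite pE conj2_not (last_state_uniq hol sp1 sq) !qE !conj2_sqnot !q1E /=; field.
- have [p1 [sp1 pE]] := last_state_neg uT hol sp.
  have [q1 [sq1 qE]] := last_state_sqneg uT hol sq.
  have q1E := last_state_Tt uT hol sq1.
  by rewrite pE conj2_not (last_state_uniq hol sp1 sq) !qE !conj2_sqnot !q1E /=; field.
- have [p1 [/(last_state_sqneg uT hol)[p2 [sp2 p1E]] pE]] := last_state_neg uT hol sp.
  have [q1 [/(last_state_neg uT hol)[q2 [sq2 q1E]] qE]] := last_state_sqneg uT hol sq.
  have e := last_state_uniq hol sp2 sq2.
  by rewrite pE qE conj2_not p1E !conj2_sqnot !q1E !conj2_not !e.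
- have [p1 [sp1 pE]] := last_state_sqneg uT hol sp.
  have [p10 p01 p11] := last_state_conjf uT hol sp1.
  have [q1 [sq1 qE]] := last_state_sqneg uT hol sq.
  have q1E := last_state_Ff uT hol sq1.
  by rewrite pE qE !conj2_sqnot !q1E p10 p01 p11 /=; field.
- have [p1 [/(last_state_sqneg uT hol)[p2 [sp2 p1E]] pE]] := last_state_sqid uT hol sp.
  have [q1 [sq1 qE]] := last_state_sqid uT hol sq.
  have e := last_state_uniq hol sp2 sq1.
  (* The square root of NOT preserves the trace and the sum of the off-diagonal entries, which is
     all that the Hadamard step reads. *)
  rewrite pE qE !conj2_sqid !p1E !conj2_sqnot !e /=.
  by move: 'i ii => i ii; field: ii.
- have [p1 [/(last_state_sqid uT hol)[p2 [sp2 p1E]] pE]] := last_state_sqneg uT hol sp.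
  have [q1 [/(last_state_sqneg uT hol)[q2 [sq2 q1E]] qE]] := last_state_neg uT hol sq.
  have e := last_state_uniq hol sp2 sq2.
  (* The Hadamard step negates the difference of the off-diagonal entries; so does reading the
     [false false] entry on the right-hand side. *)
  rewrite pE qE conj2_not conj2_sqnot !p1E !conj2_sqid q1E conj2_sqnot !e /=.
  by move: 'i ii => i ii; field: ii.
- have [p1 [/(last_state_sqneg uT hol)[p2 [sp2 p1E]] pE]] := last_state_sqid uT hol sp.
  have [p20 p02 p22] := last_state_conjf uT hol sp2.
  have [q1 [sq1 qE]] := last_state_sqneg uT hol sq.
  have q1E := last_state_Ff uT hol sq1.
  (* The off-diagonal entries created by the square root of NOT from a diagonal state are opposite,
     so their sum drops out. *)
  by rewrite pE qE conj2_sqid !p1E !conj2_sqnot !q1E /= p20 p02 p22; field.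
- have [p1 [/(last_state_sqid uT hol)[p2 [sp2 p1E]] pE]] := last_state_sqneg uT hol sp.
  have [p20 p02 p22] := last_state_conjf uT hol sp2.
  have [q1 [sq1 qE]] := last_state_sqneg uT hol sq.
  have q1E := last_state_Ff uT hol sq1.
  (* The Hadamard step gives a diagonal state equal off-diagonal entries, so their difference drops
     out. *)
  by rewrite pE qE !conj2_sqnot !p1E !conj2_sqid !q1E /= p20 p02 p22; field.
Qed.
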